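(* Let $s:\mathcal{X}\times\mathcal{Y}\to\mathbb{R}$ be a fixed measurable nonconformity score, $S_1,\dots,S_d$ probability distributions on $\mathcal{X}\times\mathcal{Y}$, $f$ a function as described in the context, $\rho>0$ and $\alpha\in(0,1)$. For each $i\in[d]$ let $(X_{ij},Y_{ij})_{j=1}^{m_i}$ be i.i.d. from $S_i$, set $V_{ij}=s(X_{ij},Y_{ij})$ (so $V_{ij}\sim s\#S_i$ i.i.d.), let $\hat F_i(x)=\frac{1}{m_i}\sum_{j=1}^{m_i}\mathbb{I}_{(-\infty,x]}(V_{ij})$ and $\hat F_{\min}(x)=\min_{1\le i\le d}\hat F_i(x)$. Let $(X_{n+1},Y_{n+1})$ be such that $V_{n+1}=s(X_{n+1},Y_{n+1})\sim P$ for some $P\in\mathcal{P}_{f,\rho}$, with $V_{n+1}$ independent of $\{V_{ij}\}$. Let $\rho^\star\coloneqq\inf_{P_0\in\mathcal{CH}(s\#S_1,\dots,s\#S_d)}D_f(P\Vert P_0)$ (so $\rho^\star\le\rho$). Set $t\coloneqq\mathcal{Q}\left(g_{f,\rho}^{-1}(1-\alpha);\hat F_{\min}\right)$ and $\widetilde{\mathcal{C}}(x)\coloneqq\{y\in\mathcal{Y}: s(x,y)\le t\}$. Then for any $\epsilon>0$, $$\mathbb{P}\left(Y_{n+1}\in\widetilde{\mathcal{C}}(X_{n+1})\right)\ge\left(1-2\sum_{i=1}^de^{-2m_i\epsilon^2}\right)g_{f,\rho^\star}\left(g_{f,\rho}^{-1}(1-\alpha)-\epsilon\right),$$ where the probability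 is over the source samples and $(X_{n+1},Y_{n+1})$.
   Context: $f:\mathbb{R}\to\mathbb{R}\cup\{+\infty\}$ is a closed convex function with $f(1)=0$ and $f(t)=+\infty$ for $t<0$; for $P\ll Q$, $D_f(P\Vert Q)\coloneqq\int f\left(\frac{dP}{dQ}\right)dQ$. $\mathcal{CH}(P_1,\dots,P_d)\coloneqq\{\sum_i\lambda_iP_i:\lambda_i\ge0,\sum_i\lambda_i=1\}$; $s\#T$ is the push-forward $(s\#T)(A)=T(s^{-1}(A))$. $\mathcal{P}_{f,\rho}\coloneqq\{S\text{ a distribution on }\mathbb{R}:\exists S_0\in\mathcal{CH}(s\#S_1,\dots,s\#S_d),\ D_f(S\Vert S_0)\le\rho\}$. For $r\ge0$, $g_{f,r}(\beta)\coloneqq\inf\{z\in[0,1]:\beta f(z/\beta)+(1-\beta)f((1-z)/(1-\beta))\le r\}$ for $\beta\in[0,1]$, and $g_{f,r}^{-1}(\tau)\coloneqq\sup\{\beta\in[0,1]:g_{f,r}(\beta)\le\tau\}$. For a c.d.f. $F$, $\mathcal{Q}(\beta;F)\coloneqq\inf\{q:F(q)\ge\beta\}$. *)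

(* Defs.v *)
From HB Require Import structures.
From mathcomp Require Import all_boot all_order all_algebra.
From mathcomp Require Import all_classical all_reals all_analysis.
Set Implicit Arguments. Unset Strict Implicit. Unset Printing Implicit Defensive.
Import Order.TTheory GRing.Theory Num.Theory.
Import numFieldNormedType.Exports.
Local Open Scope classical_set_scope.
Local Open Scope ring_scope.

Section Defs.
Context {R : realType}.

Definition fdiv_generator (f : R -> \bar R) : Prop :=
  [/\ (forall x, f x != -oo%E),
      (forall a : R, closed [set x | (f x <= a%:E)%E]),
      (forall (x y lam : R), 0 <= lam <= 1 ->
          (f (lam * x + (1 - lam) * y)%R <= lam%:E * f x + (1 - lam)%:E * f y)%E),
      f 1 = 0%E &
      (forall t, t < 0 -> f t = +oo%E)].

Definition is_density (h : R -> R) (Q Q0 : {measure set R -> \bar R}) : Prop :=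
  [/\ measurable_fun setT h, (forall x, 0 <= h x) &
      forall A, measurable A -> Q A = (\int[Q0]_(x in A) (h x)%:E)%E].

(* D_f(Q || Q0) := int f(dQ/dQ0) dQ0 when Q << Q0; +oo otherwise
   (the infimum of the empty set is +oo; densities are a.e. unique so
   all elements of the set coincide). *)
Definition fdiv (f : R -> \bar R) (Q Q0 : {measure set R -> \bar R}) : \bar R :=
  ereal_inf [set (\int[Q0]_x f (h x))%E | h in [set h | is_density h Q Q0]].

Definition pushfwd {d} {T : measurableType d} (s : T -> R)
  (S : set T -> \bar R) : set R -> \bar R := fun A => S (s @^-1` A).

Definition in_convex_hull (n : nat) (Ps : 'I_n -> set R -> \bar R)
  (Q0 : set R -> \bar R) : Prop :=
  exists lam : 'I_n -> R, [/\ (forall i, 0 <= lam i), \sum_(i < n) lam i = 1 &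
    forall A, measurable A -> Q0 A = (\sum_(i < n) (lam i)%:E * Ps i A)%E].

(* beta * f(z / beta), with the f-divergence conventions
   0 * f(0/0) = 0 and 0 * f(z/0) = +oo for z > 0 (no absolute continuity) *)
Definition persp (f : R -> \bar R) (beta z : R) : \bar R :=
  if 0 < beta then (beta%:E * f (z / beta)%R)%E
  else if z == 0 then 0%E else +oo%E.

Definition gfun (f : R -> \bar R) (r : \bar R) (beta : R) : R :=
  let b := Num.max 0 (Num.min beta 1) in
  inf [set z : R | 0 <= z <= 1 /\ (persp f b z + persp f (1 - b)%R (1 - z)%R <= r)%E].

Definition gfun_inv (f : R -> \bar R) (r : \bar R) (tau : R) : R :=
  sup [set beta : R | 0 <= beta <= 1 /\ gfun f r beta <= tau].

Definition quantile (beta : R) (F : R -> R) : R := inf [set q : R | beta <= F q].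

End Defs.

(* Main.v *)
(** Write [beta := gfun_inv f rho (1 - alpha)] and [b := beta - eps]; only [0 < b]
   matters. Let [q i] be a [b]-quantile of the score under [S i], and let
   [q0 = q i0] be the largest of the [q i]. Every [S i] puts mass at least [b] on
   [s <= q0], hence so does every mixture [P0], and data processing of the
   f-divergence for the event [V <= q0] gives
   [P (V <= q0) >= gfun f rho_star b]. On the other hand [S i0] puts mass at most
   [b] on [s < q0], and [t < q0] forces a fraction at least [beta = b + eps] of
   the [i0]-th sample to lie below [q0]. Since [q0] is deterministic, Hoeffding's
   inequality for a single binomial bounds the probability of this event by
   [expR (- 2 m_i0 eps^2)]; no uniform (DKW) bound is needed. Independence of
   the test point then yields
   [Pr (V <= t) >= P (V <= q0) * (1 - expR (- 2 m_i0 eps^2))]. *)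

Require Import Defs.
From HB Require Import structures.
From mathcomp Require Import all_boot all_order all_algebra.
From mathcomp Require Import all_classical all_reals all_analysis.
From mathcomp Require Import measurable_realfun ring lra.
Import Order.TTheory GRing.Theory Num.Theory.
Import numFieldNormedType.Exports.
Local Open Scope classical_set_scope.
Local Open Scope ring_scope.

(** * Data processing for f-divergences *)

Lemma fdiv_generator_gt_near (R : realType) (f : R -> \bar R) (c x : R) :
  fdiv_generator f -> (c%:E < f x)%E ->
  exists2 del : R, 0 < del &
    forall y, `|y - x| < del -> (c%:E < f y)%E.
Proof.
move=> [_ f_cl _ _ _] cfx.
have : nbhs x (~` [set y | (f y <= c%:E)%E]).
  apply: open_nbhs_nbhs; split; first exact/closed_openC/f_cl.
  by move=> /=; apply/negP; rewrite -ltNge.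
move=> /nbhs_ballP[del /= del0 xdel]; exists del => // y yx.
have /xdel /= : ball x del y by rewrite /ball/= distrC.
by move/negP; rewrite -ltNge.
Qed.

(* [f] exceeds [-1] near [1], and convexity carries this bound along the chords
   issued from the point [(1, f 1) = (1, 0)]. *)
Lemma fdiv_generator_lower_bound (R : realType) (f : R -> \bar R) :
  fdiv_generator f ->
  exists2 K : R, 0 <= K & forall y, ((- (1 + K * `|y - 1|))%:E <= f y)%E.
Proof.
move=> f_gen; have [f_ninf _ f_conv f1 _] := f_gen.
have [|del del0 near1] := @fdiv_generator_gt_near _ f (-1) 1 f_gen.
  by rewrite f1 lte_fin ltrN10.
exists del^-1 => [|y]; first by rewrite invr_ge0 ltW.
set a := `|y - 1|; have a0 : 0 <= a by exact: normr_ge0.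
have da0 : 0 < del + a by rewrite ltr_wpDr.
pose lam := del / (del + a).
have lam0 : 0 < lam by rewrite divr_gt0.
have lam1 : lam <= 1 by rewrite ler_pdivrMr// mul1r lerDl.
have lamE : lam * (1 + del^-1 * a) = 1.
  by rewrite /lam; field; rewrite !gt_eqF.
have /near1 : `|lam * y + (1 - lam) * 1 - 1| < del.
  have -> : lam * y + (1 - lam) * 1 - 1 = lam * (y - 1) by ring.
  rewrite normrM (gtr0_norm lam0) -/a /lam mulrAC ltr_pdivrMr//.
  by rewrite ltr_pM2l// ltrDr.
move=> fx; have := f_conv y 1 lam; rewrite (ltW lam0) lam1 => /(_ isT).
rewrite f1 mule0 adde0 => /(lt_le_trans fx).
have := f_ninf y; case: (f y) => [r| |] // _.
  rewrite -EFinM !lte_fin !lee_fin => lamr.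
  by rewrite -(ler_pM2l lam0) mulrN lamE ltW.
by rewrite leey.
Qed.

(** The bound [c] holds near [mu]; farther away a steep enough cone absorbs the linear lower bound.
    The cone keeps the slopes of the next lemma bounded even where [f] is infinite. *)
Lemma fdiv_generator_cone (R : realType) (f : R -> \bar R) (c mu : R) :
  fdiv_generator f -> (c%:E < f mu)%E ->
  exists2 B : R, 0 <= B & forall x, ((c - B * `|x - mu|)%:E <= f x)%E.
Proof.
move=> f_gen cf.
have [del del0 nearmu] := @fdiv_generator_gt_near _ f c mu f_gen cf.
have [K K0 Kf] := @fdiv_generator_lower_bound _ f f_gen.
(* At distance at least [del] from [mu], the slope [C / del] contributes at least [C], which pays
   for [c] and for the constant in the linear bound. *)
pose C := `|c| + 1 + K * `|mu - 1|.
have C0 : 0 <= C by rewrite !addr_ge0// mulr_ge0.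
exists (K + C / del) => [|x]; first by rewrite addr_ge0// divr_ge0// ltW.
have [xmu|xmu] := ltP `|x - mu| del.
  apply: le_trans (ltW (nearmu x xmu)); rewrite lee_fin gerBl.
  by rewrite mulr_ge0// addr_ge0// divr_ge0// ltW.
apply: le_trans (Kf x); rewrite lee_fin.
have h1 : `|x - 1| <= `|x - mu| + `|mu - 1|.
  by apply: le_trans (ler_normD _ _); rewrite addrA subrK.
have h2 : C <= C / del * `|x - mu|.
  by rewrite mulrAC ler_pdivlMr// ler_wpM2l.
have h3 : K * `|x - 1| <= K * `|x - mu| + K * `|mu - 1|.
  by rewrite -mulrDr ler_wpM2l.
have h4 : c <= `|c| by exact: ler_norm.
by rewrite /C in h2 *; lra.
Qed.

(** Slopes are taken through [(mu, c)], since [f mu] may be infinite. By convexity every slope from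
    the left is at most every slope to the right, and any number in between serves. *)
Lemma fdiv_generator_affine_minorant (R : realType) (f : R -> \bar R) (c mu : R) :
  fdiv_generator f -> (c%:E < f mu)%E ->
  exists k : R, forall x, ((c + k * (x - mu))%:E <= f x)%E.
Proof.
move=> f_gen cf; have [f_ninf _ f_conv _ _] := f_gen.
have [B B0 Bf] := @fdiv_generator_cone _ f c mu f_gen cf.
(* [- B] keeps the set nonempty when [f] is infinite on the left of [mu]. *)
pose E := [set k : R | k = - B \/
  exists y r, [/\ y < mu, f y = r%:E & k = (c - r) / (mu - y)]].
have E_le x r : mu < x -> f x = r%:E -> ubound E ((r - c) / (x - mu)).
  move=> mux fx _ [->|[y [r' [ymu fy ->]]]].
    rewrite ler_pdivlMr ?subr_gt0//.
    have := Bf x; rewrite fx lee_fin (gtr0_norm (_ : 0 < x - mu)) ?subr_gt0//.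
    lra.
  pose l := (x - mu) / (x - y).
  have xy0 : 0 < x - y by rewrite subr_gt0 (lt_trans ymu).
  have l01 : 0 <= l <= 1.
    apply/andP; split; first by rewrite divr_ge0 ?(ltW xy0)// subr_ge0 ltW.
    by rewrite ler_pdivrMr// mul1r lerB// ltW.
  have := f_conv y x l l01.
  have -> : l * y + (1 - l) * x = mu by rewrite /l; field; rewrite gt_eqF.
  rewrite fx fy -!EFinM -EFinD => /(lt_le_trans cf); rewrite lte_fin => h.
  rewrite ler_pdivrMr ?subr_gt0// mulrAC ler_pdivlMr ?subr_gt0//.
  have : c * (x - y) < (l * r' + (1 - l) * r) * (x - y) by rewrite ltr_pM2r.
  have -> : (l * r' + (1 - l) * r) * (x - y) = (x - mu) * r' + (mu - y) * r.
    by rewrite /l; field; rewrite gt_eqF.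
  lra.
have E_ub : has_ubound E.
  exists B => _ [->|[y [r [ymu fy ->]]]]; first lra.
  rewrite ler_pdivrMr ?subr_gt0//.
  have := Bf y; rewrite fy lee_fin (ltr0_norm (_ : y - mu < 0)) ?subr_lt0//.
  lra.
exists (sup E) => x; have := f_ninf x.
case fx : (f x) => [r| |] // _; last by rewrite leey.
rewrite lee_fin; have [xmu|mux|xmu] := ltgtP x mu.
- have : (c - r) / (mu - x) <= sup E.
    by apply: ub_le_sup => //; right; exists x, r.
  rewrite ler_pdivrMr ?subr_gt0//; lra.
- have : sup E <= (r - c) / (x - mu).
    by apply: ge_sup; [exists (- B); left|exact: E_le].
  rewrite ler_pdivlMr ?subr_gt0//; lra.
- by move: cf; rewrite -xmu fx lte_fin; lra.
Qed.

Lemma fdiv_generator_measurable (R : realType) (f : R -> \bar R) :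
  fdiv_generator f -> measurable_fun setT f.
Proof.
move=> [_ f_cl _ _ _]; apply: lower_semicontinuous_measurable.
apply/lower_semicontinuousP => a.
rewrite (_ : [set x | _] = ~` [set x | (f x <= a%:E)%E]).
  exact/closed_openC/f_cl.
by apply/seteqP; split => x /=; rewrite ltNge => /negP.
Qed.

(** Comparing positive and negative parts separately covers functions that are not integrable, such
    as [f \o h] when the divergence is infinite. *)
Lemma le_integral_minorant {d} (T : measurableType d) (R : realType)
    (mu : {measure set T -> \bar R}) (D : set T) (g F : T -> \bar R) :
  measurable D -> measurable_fun D g -> measurable_fun D F ->
  (forall x, D x -> (g x <= F x)%E) ->
  (\int[mu]_(x in D) g x <= \int[mu]_(x in D) F x)%E.
Proof.
move=> mD mg mF gF; rewrite integralE [leRHS]integralE leeB//.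
- apply: ge0_le_integral => //; [exact: measurable_funepos..|].
  by move=> x Dx; apply: (@funepos_le _ _ D) => [y|]; rewrite inE//; exact: gF.
- apply: ge0_le_integral => //; [exact: measurable_funeneg..|].
  by move=> x Dx; apply: (@funeneg_le _ _ D) => [y|]; rewrite inE//; exact: gF.
Qed.

Lemma integral_affine_density (R : realType) (Q Q0 : probability R R)
    (h : R -> R) (a k : R) (A : set R) :
  is_density h Q Q0 -> measurable A ->
  (\int[Q0]_(x in A) (a + k * h x)%:E =
    (a * fine (Q0 A) + k * fine (Q A))%:E)%E.
Proof.
move=> [mh h0 QE] mA.
have ih : Q0.-integrable A (fun x => (h x)%:E).
  apply/integrableP; split.
    by apply/measurable_EFinP; exact: measurable_funTS.
  under eq_integral do rewrite gee0_abs ?lee_fin//.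
  by rewrite -QE// (le_lt_trans (probability_le1 _ _))// ltry.
under eq_integral do rewrite EFinD EFinM.
rewrite integralD//=; last 2 first.
- exact: finite_measure_integrable_cst.
- exact: integrableZl.
rewrite integralZl// -QE// (integral_cst _ mA) EFinD !EFinM.
by rewrite !fineK// fin_num_measure.
Qed.

Lemma density_null (R : realType) (Q Q0 : probability R R) (h : R -> R)
    (A : set R) :
  is_density h Q Q0 -> measurable A -> Q0 A = 0%E -> Q A = 0%E.
Proof.
move=> [mh _ QE] mA A0; rewrite QE// null_set_integral//.
by apply/measurable_EFinP; exact: measurable_funTS.
Qed.

(** Jensen's inequality in linearised form: [a + k * h], integrated over a cell of mass [b] under
    [Q0] and [z] under [Q], gives [a * b + k * z]. The premise [b = 0 -> z = 0] is absolute
    continuity. *)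
Lemma persp_affine_minorant (R : realType) (f : R -> \bar R) (b z e : R) :
  fdiv_generator f -> 0 <= b -> (b = 0 -> z = 0) -> (e%:E < persp f b z)%E ->
  exists a k, (forall x, ((a + k * x)%:E <= f x)%E) /\ e <= a * b + k * z.
Proof.
move=> f_gen; rewrite le_eqVlt => /predU1P[<- /(_ erefl) ->|b0 _].
  (* The perspective is [0] here, so [e < 0] and every affine minorant serves. *)
  rewrite /persp ltxx eqxx lte_fin => e0.
  have [|k fk] := @fdiv_generator_affine_minorant _ f (-1) 1 f_gen.
    by case: f_gen => _ _ _ -> _; rewrite lte_fin ltrN10.
  exists (- 1 - k), k; rewrite !mulr0 addr0; split; last exact: ltW.
  by move=> x; apply: le_trans (fk x); rewrite lee_fin; lra.
rewrite /persp b0 => ef.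
(* At [z / b] the minorant takes the value [e / b]; scaling by [b] returns exactly [e]. *)
have [|k fk] := @fdiv_generator_affine_minorant _ f (e / b) (z / b) f_gen.
  by rewrite -(@lte_pmul2l _ b%:E) ?lte_fin// -EFinM mulrC divfK// gt_eqF.
exists (e / b - k * (z / b)), k; split => [x|].
  by apply: le_trans (fk x); rewrite lee_fin; lra.
rewrite le_eqVlt; apply/orP; left; apply/eqP; field.
by rewrite gt_eqF.
Qed.

(** Affine minorants are available only for heights strictly below [f], so each summand, possibly
    infinite, is approached from below by reals. *)
Lemma leeD_approx (R : realType) (p1 p2 I : \bar R) :
  (p1 != -oo -> p2 != -oo ->
  (forall e1 e2 : R, e1%:E < p1 -> e2%:E < p2 -> (e1 + e2)%:E <= I) ->
  p1 + p2 <= I)%E.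
Proof.
move=> p1N p2N H; rewrite leNgt; apply/negP.
have ex p : p != -oo%E -> exists e : R, (e%:E < p)%E.
  case: p => [r| |] // _; last by exists 0; rewrite ltry.
  by exists (r - 1); rewrite lte_fin; lra.
case: p1 p1N H => [r1| |] // _; case: p2 p2N => [r2| |] // _ H.
- case: I H => [r| |] // H.
    (* Lowering each summand by a third of the excess keeps the sum above [r]. *)
    rewrite -EFinD lte_fin => h; pose t := (r1 + r2 - r) / 3.
    have := H (r1 - t) (r2 - t); rewrite !lte_fin lee_fin.
    have t0 : 0 < t by rewrite /t; lra.
    by move=> /(_ ltac:(lra) ltac:(lra)); rewrite /t; lra.
  by have := H (r1 - 1) (r2 - 1); rewrite !lte_fin => /(_ ltac:(lra) ltac:(lra)).
- case: I H => [r| |] // H _.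
    have := H (r1 - 1) (r - r1 + 2); rewrite !lte_fin ltry lee_fin.
    by move=> /(_ ltac:(lra) isT); lra.
  by have := H (r1 - 1) 0; rewrite !lte_fin ltry => /(_ ltac:(lra) isT).
- case: I H => [r| |] // H _.
    have := H (r - r2 + 2) (r2 - 1); rewrite !lte_fin ltry lee_fin.
    by move=> /(_ isT ltac:(lra)); lra.
  by have := H 0 (r2 - 1); rewrite !lte_fin ltry => /(_ isT ltac:(lra)).
- case: I H => [r| |] // H _.
    by have := H r 1; rewrite !ltry lee_fin => /(_ isT isT); lra.
  by have := H 0 0; rewrite !ltry => /(_ isT isT).
Qed.

Lemma persp_neqNy (R : realType) (f : R -> \bar R) (b z : R) :
  fdiv_generator f -> persp f b z != -oo%E.
Proof.
move=> [f_ninf _ _ _ _]; rewrite /persp; case: ifPn => b0; last by case: ifP.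
by have := f_ninf (z / b); case: (f _) => [r| |] //= _; rewrite gt0_muley ?lte_fin.
Qed.

(* Data processing for the two-cell partition [A], [~` A], by Jensen's
   inequality on each cell. *)
Lemma fdiv_ge_binary (R : realType) (f : R -> \bar R) (Q Q0 : probability R R)
    (A : set R) :
  fdiv_generator f -> measurable A ->
  (persp f (fine (Q0 A)) (fine (Q A)) +
   persp f (1 - fine (Q0 A))%R (1 - fine (Q A))%R <= fdiv f Q Q0)%E.
Proof.
move=> f_gen mA; apply: le_ereal_inf_tmp => _ [h hd <-].
have mAC : measurable (~` A) by exact: measurableC.
have fC (P : probability R R) : 1 - fine (P A) = fine (P (~` A)).
  by rewrite probability_setC// fineB// fin_num_measure.
rewrite !fC; apply: leeD_approx; [exact: persp_neqNy..|].
have ac B : measurable B -> fine (Q0 B) = 0 -> fine (Q B) = 0.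
  move=> mB B0; rewrite (density_null _ _ _ _ _ hd mB)//.
  by rewrite -[LHS]fineK ?fin_num_measure// B0.
have mF : measurable_fun setT (f \o h).
  apply: measurableT_comp => //; first exact: fdiv_generator_measurable.
  by case: hd.
have cell B e : measurable B -> (e%:E < persp f (fine (Q0 B)) (fine (Q B)))%E ->
    (e%:E <= \int[Q0]_(x in B) f (h x))%E.
  move=> mB /(persp_affine_minorant _ _ _ _ _ f_gen (fine_ge0 (measure_ge0 _ _)) (ac _ mB)).
  move=> [a [k [fak eak]]].
  apply: (@le_trans _ _ (\int[Q0]_(x in B) (a + k * h x)%:E)%E).
    by rewrite (integral_affine_density _ Q)// lee_fin.
  apply: le_integral_minorant => //; last exact: measurable_funTS.
  apply/measurable_EFinP; apply: measurable_funTS.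
  by apply: measurable_funD => //; apply: measurable_funM => //; case: hd.
move=> e1 e2 /(cell _ _ mA) h1 /(cell _ _ mAC) h2.
rewrite -(setUv A) integral_setU//.
- by rewrite EFinD leeD.
- by rewrite setUv.
- by apply/eqP/seteqP; split => x; rewrite //= => -[].
Qed.

(** * The function [gfun] *)

Lemma persp_diag (R : realType) (f : R -> \bar R) (b : R) :
  fdiv_generator f -> 0 <= b -> persp f b b = 0%E.
Proof.
move=> [_ _ _ f1 _]; rewrite /persp le_eqVlt => /predU1P[<-|b0].
  by rewrite ltxx eqxx.
by rewrite b0 divff ?gt_eqF// f1 mule0.
Qed.

(** The perspective is convex and vanishes at [(z, z)], so moving its first argument from [b]
    towards [z] shrinks it at least linearly. *)
Lemma persp_chord (R : realType) (f : R -> \bar R) (lam b z : R) :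
  fdiv_generator f -> 0 <= lam <= 1 -> 0 <= z -> 0 < b ->
  0 < lam * z + (1 - lam) * b ->
  (persp f (lam * z + (1 - lam) * b) z <= (1 - lam)%:E * persp f b z)%E.
Proof.
move=> f_gen /andP[l0 l1] z0 b0; set c := lam * z + _ => c0.
have [_ _ f_conv f1 _] := f_gen.
rewrite /persp c0 b0.
pose mu := lam * z / c.
have cE : (1 - mu) * c = (1 - lam) * b.
  by rewrite /mu /c; field; rewrite gt_eqF.
have mu01 : 0 <= mu <= 1.
  rewrite divr_ge0 ?mulr_ge0 ?(ltW c0)//= ler_pdivrMr// mul1r lerDl.
  by rewrite mulr_ge0 ?subr_ge0// ltW.
have := f_conv 1 (z / b) mu mu01; rewrite f1 mule0 add0e.
have -> : mu * 1 + (1 - mu) * (z / b) = z / c.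
  have -> : 1 - mu = (1 - lam) * b / c by rewrite -cE mulfK// gt_eqF.
  by rewrite /mu; field; rewrite !gt_eqF.
move=> h; rewrite muleA -EFinM -cE [(1 - mu) * c]mulrC EFinM -muleA lee_pmul2l//.
Qed.

Section binary_divergence.
Context {R : realType} (f : R -> \bar R) (f_gen : fdiv_generator f).

(** The f-divergence of the Bernoulli law of parameter [z] from that of parameter [b]: the quantity
    constrained in [gfun]. *)
Let binary_div (b z : R) : \bar R :=
  (persp f b z + persp f (1 - b)%R (1 - z)%R)%E.

Lemma binary_div_diag b : 0 <= b <= 1 -> binary_div b b = 0%E.
Proof.
by move=> /andP[b0 b1]; rewrite /binary_div !persp_diag ?subr_ge0// adde0.
Qed.

Lemma persp0 z : persp f 0 z = if z == 0 then 0%E else +oo%E.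
Proof. by rewrite /persp ltxx. Qed.

(** For [0 < b < 1] this is Jensen: [z / b] and [(1 - z) / (1 - b)] have weighted mean [1], and
    [f 1 = 0]. At an endpoint with [z != b] one perspective is infinite. *)
Lemma binary_div_ge0 b z : 0 <= b <= 1 -> (0 <= binary_div b z)%E.
Proof.
move=> b01; have [_ _ f_conv f1 _] := f_gen.
have [->|zb] := eqVneq z b; first by rewrite binary_div_diag.
have oo p : p != -oo%E -> (0 <= +oo + p)%E by move=> pN; rewrite addye// leey.
move: b01 => /andP[]; rewrite /binary_div le_eqVlt => /predU1P[b0 _|b0].
  by rewrite -b0 persp0 b0 (negbTE zb) oo ?persp_neqNy.
rewrite le_eqVlt => /predU1P[b1|b1].
  rewrite b1 subrr persp0 subr_eq0 -b1 eq_sym (negbTE zb) addeC oo//.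
  exact: persp_neqNy.
have b1' : 0 < 1 - b by rewrite subr_gt0.
have := f_conv (z / b) ((1 - z) / (1 - b)) b.
have -> : b * (z / b) + (1 - b) * ((1 - z) / (1 - b)) = 1.
  by field; rewrite !gt_eqF.
by rewrite /persp b0 b1' f1 (ltW b0) (ltW b1) => /(_ isT).
Qed.

(** For fixed [z] the divergence is convex in [b] with minimum [0] at [b = z]. Here [b] is written
    as a mixture of [z] and [b'], and [persp_chord] applies to both terms. *)
Lemma binary_div_nondecreasing z b b' : 0 <= z -> z <= b -> b <= b' -> b' <= 1 ->
  (binary_div b z <= binary_div b' z)%E.
Proof.
move=> z0; rewrite le_eqVlt => /predU1P[<-|zb] bb' b'1.
  rewrite binary_div_diag; last by rewrite z0 (le_trans bb').
  by rewrite binary_div_ge0// b'1 (le_trans z0).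
have zb' : z < b' by exact: lt_le_trans bb'.
have z1 : z < 1 by exact: lt_le_trans b'1.
have b0 : 0 < b by exact: le_lt_trans zb.
move: b'1; rewrite le_eqVlt => /predU1P[->|b'1].
  rewrite {2}/binary_div subrr persp0 subr_eq0 gt_eqF//.
  by rewrite addey ?leey// persp_neqNy.
pose lam := (b' - b) / (b' - z).
have bz0 : 0 < b' - z by rewrite subr_gt0.
have l0 : 0 <= lam by rewrite divr_ge0 ?subr_ge0// ltW.
have l1 : lam <= 1 by rewrite ler_pdivrMr// mul1r lerB// ltW.
have bE : b = lam * z + (1 - lam) * b' by rewrite /lam; field; rewrite gt_eqF.
have bE' : 1 - b = lam * (1 - z) + (1 - lam) * (1 - b') by rewrite {1}bE; ring.
have b'01 : 0 <= b' <= 1 by rewrite (ltW b'1) (le_trans (ltW b0)).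
apply: (@le_trans _ _ ((1 - lam)%:E * binary_div b' z)%E); last first.
  by rewrite gee_pMl ?binary_div_ge0// ?lee_fin ?subr_ge0// gerBl.
rewrite /binary_div muleDr//; last first.
  rewrite /adde_def.
  by case: (persp f b' z) (persp_neqNy _ f b' z f_gen) => [?||]//= _;
     case: (persp f (1 - b') (1 - z)) (persp_neqNy _ f (1 - b') (1 - z) f_gen).
apply: leeD.
  by rewrite {1}bE persp_chord ?l0 -?bE// (lt_le_trans b0).
rewrite {1}bE' persp_chord ?l0 -?bE'// ?subr_ge0 ?subr_gt0 ?ltW//.
by rewrite (le_lt_trans bb').
Qed.

End binary_divergence.

Lemma gfun_ge0 (R : realType) (f : R -> \bar R) (r : \bar R) (b : R) :
  0 <= gfun f r b.
Proof.
rewrite /gfun; set E := [set z | _].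
have [->|E0] := eqVneq E set0; first by rewrite inf0.
by apply: lb_le_inf; [exact/set0P|move=> z [/andP[]]].
Qed.

(** Only [z < b] calls for a check: when [b <= z], the point [b] itself is feasible with divergence
    [0]. *)
Lemma gfun_le (R : realType) (f : R -> \bar R) (r : \bar R) (b z : R) :
  fdiv_generator f -> (0 <= r)%E -> 0 <= b <= 1 -> 0 <= z <= 1 ->
  (z < b -> (persp f b z + persp f (1 - b)%R (1 - z)%R <= r)%E) ->
  gfun f r b <= z.
Proof.
move=> f_gen r0 /andP[b0 b1] /andP[z0 z1] zr; rewrite /gfun.
rewrite (min_idPl b1) (max_idPr b0).
have lbE : has_lbound [set z : R | 0 <= z <= 1 /\
    (persp f b z + persp f (1 - b)%R (1 - z)%R <= r)%E].
  by exists 0 => y [/andP[]].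
have [/zr zr'|bz] := ltP z b; first by apply: ge_inf => //; split=> //; exact/andP.
apply: le_trans bz; apply: ge_inf => //; split; first exact/andP.
by rewrite binary_div_diag// b0.
Qed.

Lemma gfun_le0 (R : realType) (f : R -> \bar R) (r : \bar R) (b : R) :
  fdiv_generator f -> (0 <= r)%E -> b <= 0 -> gfun f r b = 0.
Proof.
move=> f_gen r0 b0; apply/eqP; rewrite eq_le gfun_ge0 andbT.
have -> : gfun f r b = gfun f r 0.
  rewrite /gfun (min_idPl ler01) (min_idPl (le_trans b0 ler01)).
  by rewrite (max_idPl b0) maxxx.
by apply: gfun_le; rewrite ?lexx ?ler01// ltxx.
Qed.

Lemma in_convex_hull_ge (R : realType) (n : nat) (Ps : 'I_n -> set R -> \bar R)
    (Q0 : set R -> \bar R) (A : set R) (b : R) :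
  in_convex_hull Ps Q0 -> measurable A -> (forall i, (b%:E <= Ps i A)%E) ->
  (b%:E <= Q0 A)%E.
Proof.
move=> [lam [lam0 lam1 QE]] mA bP; rewrite QE//.
have -> : b%:E = (\sum_(i < n) (lam i)%:E * b%:E)%E.
  under eq_bigr do rewrite -EFinM.
  by rewrite sumEFin -mulr_suml lam1 mul1r.
by apply: lee_sum => i _; rewrite lee_wpmul2l// lee_fin.
Qed.

Lemma fdiv_ge0 (R : realType) (f : R -> \bar R) (Q Q0 : probability R R) :
  fdiv_generator f -> (0 <= fdiv f Q Q0)%E.
Proof.
move=> f_gen; have := fdiv_ge_binary _ f Q Q0 setT f_gen measurableT.
by rewrite !probability_setT /= binary_div_diag// ler01 lexx.
Qed.

Lemma gfun_inv_le1 (R : realType) (f : R -> \bar R) (r : \bar R) (tau : R) :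
  gfun_inv f r tau <= 1.
Proof.
rewrite /gfun_inv; set E := [set x | _].
have [->|/set0P E0] := eqVneq E set0; first by rewrite sup0.
by apply: ge_sup => // x [/andP[]].
Qed.

(* [b <= Q0 A] for every [Q0] in the hull, so monotonicity of the binary
   divergence in its first argument replaces [Q0 A] by [b] before the infimum
   over the hull is taken: attainment of the infimum is not needed. *)
Lemma gfun_hull_le (R : realType) (f : R -> \bar R) (n : nat)
    (Ps : 'I_n -> set R -> \bar R) (P : probability R R) (A : set R) (b : R) :
  fdiv_generator f -> measurable A -> 0 <= b -> b <= 1 ->
  (forall i, (b%:E <= Ps i A)%E) ->
  gfun f (ereal_inf [set fdiv f P P0 | P0 in
      [set P0 : probability R R | in_convex_hull Ps P0]]) b <= fine (P A).
Proof.
move=> f_gen mA b0 b1 bP.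
have fine01 (Q : probability R R) : 0 <= fine (Q A) <= 1.
  by rewrite fine_ge0// -lee_fin fineK ?fin_num_measure// probability_le1.
apply: gfun_le => //.
- by apply: le_ereal_inf_tmp => _ [P0 _ <-]; exact: fdiv_ge0.
- by rewrite b0.
- move=> zb; apply: le_ereal_inf_tmp => _ [P0 /= hP0 <-].
  apply: le_trans (fdiv_ge_binary _ f P P0 A f_gen mA).
  have /andP[_ P01] := fine01 P0; have /andP[P0' _] := fine01 P.
  apply: binary_div_nondecreasing => //; first exact: ltW.
  rewrite -lee_fin fineK ?fin_num_measure//.
  exact: in_convex_hull_ge hP0 mA bP.
Qed.

(** * Hoeffding's inequality *)

Lemma le_of_derive_ge0 (R : realType) (F dF : R -> R) (a : R) :
  0 <= a -> (forall x, is_derive x (1 : R) F (dF x)) ->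
  (forall x, 0 <= x -> 0 <= dF x) -> F 0 <= F a.
Proof.
move=> a0 dFE dF0.
have [|c] := @MVT_segment _ F dF 0 a a0 (fun x _ => dFE x).
  by apply: derivable_within_continuous => x _; have [] := dFE x.
rewrite in_itv/= => /andP[c0 _]; rewrite subr0 -subr_ge0 => ->.
by rewrite mulr_ge0// dF0.
Qed.

(* Hoeffding's lemma for a Bernoulli variable: the second derivative of the
   cumulant generating function is a product [t (1 - t) <= 1/4]. *)
Lemma bernoulli_mgf_le (R : realType) (p x : R) :
  0 <= p <= 1 -> 0 <= x ->
  1 - p + p * expR x <= expR (p * x + x ^+ 2 / 8).
Proof.
move=> /andP[p0 p1] x0.
pose u (y : R) := 1 - p + p * expR y.
have u0 y : 0 < u y.
  rewrite /u; have := expR_gt0 y; move: p0; rewrite le_eqVlt => /predU1P[<-|p0].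
    by move=> _; lra.
  by move=> /(mulr_gt0 p0); lra.
have du y : is_derive y (1 : R) u (p * expR y).
  rewrite /u; apply: is_derive_eq.
  by rewrite /GRing.scale /=; ring.
(* [G] is the claimed exponent minus the cumulant generating function and [H] is its derivative.
   Both vanish at [0], so it suffices that [H] has a nonnegative derivative. *)
pose G (y : R) := y ^+ 2 / 8 + p * y - ln (u y).
pose H (y : R) := y / 4 + p - p * expR y / u y.
have dG y : is_derive y (1 : R) G (H y).
  have dln : is_derive y (1 : R) (@ln R \o u) (p * expR y * (u y)^-1).
    rewrite mulrC; apply: is_derive1_comp; exact: is_derive1_ln.
  rewrite /G; apply: is_derive_eq.
  by rewrite /GRing.scale /= /H; field; rewrite gt_eqF.
have dH y : is_derive y (1 : R) H (4^-1 - p * (1 - p) * expR y / u y ^+ 2).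
  have dV : is_derive y (1 : R) (fun y => (u y)^-1) (- (u y) ^- 2 *: (p * expR y)).
    by apply: is_deriveV; rewrite gt_eqF.
  rewrite /H; apply: is_derive_eq.
  rewrite /GRing.scale /=; have := u0 y; rewrite /u => uy0.
  by field; rewrite gt_eqF.
have H0 y : 0 <= y -> 0 <= H y.
  move=> y0; have <- : H 0 = 0.
    by rewrite /H /u expR0 mulr1 subrK; field.
  apply: (@le_of_derive_ge0 _ H _ y y0 dH) => z _.
  rewrite subr_ge0 ler_pdivrMr ?exprn_gt0//.
  (* This is [4 a b <= (a + b)^2] for [a = 1 - p] and [b = p * expR z]. *)
  rewrite /u; have := sqr_ge0 (1 - p - p * expR z); lra.
have : 0 <= G x.
  have <- : G 0 = 0 by rewrite /G /u expR0 mulr1 subrK ln1; ring.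
  exact: (@le_of_derive_ge0 _ G _ x x0 dG).
rewrite /G subr_ge0 => h.
rewrite -[1 - p + _]/(u x).
have -> : u x = expR (ln (u x)) by rewrite lnK// posrE.
by rewrite ler_expR addrC.
Qed.

Lemma le_measure_bigcup_fin {d} (T : measurableType d) (R : realType)
    (mu : {measure set T -> \bar R}) (I : finType) (Q : {pred I})
    (A : I -> set T) (B : set T) :
  (forall i, measurable (A i)) -> measurable B ->
  (forall x, B x -> exists2 i, Q i & A i x) ->
  (mu B <= \sum_(i | Q i) mu (A i))%E.
Proof.
move=> mA mB BA.
apply: (@le_trans _ _ (mu (\big[setU/set0]_(i | Q i) A i))).
  apply: le_measure; rewrite ?inE//; first exact: bigsetU_measurable.
  by move=> x /BA[i Qi Aix]; rewrite (bigD1 i)//=; left.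
suff [] : (mu (\big[setU/set0]_(i | Q i) A i) <= \sum_(i | Q i) mu (A i))%E /\
  measurable (\big[setU/set0]_(i | Q i) A i) by [].
elim/big_ind2 : _ => [|x1 x2 y1 y2 [h1 m1] [h2 m2]|i _]; rewrite ?measure0//.
split; last exact: measurableU.
by apply: le_trans (measureU2 _ _ _) _ => //; exact: leeD.
Qed.

(** With [y = expR lam] this is the moment generating function of a binomial variable, expanded over
    the outcomes [c] of the trials. *)
Lemma sum_prod_bernoulli (R : realType) (m : nat) (p y : R) :
  \sum_(c : {ffun 'I_m -> bool})
     \prod_(j < m) ((if c j then p else 1 - p) * (if c j then y else 1)) =
  (1 - p + p * y) ^+ m.
Proof.
rewrite -(bigA_distr_bigA (fun (_ : 'I_m) (b : bool) =>
  (if b then p else 1 - p) * (if b then y else 1))).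
under eq_bigr do rewrite big_bool/= mulr1 addrC.
by rewrite prodr_const card_ord.
Qed.

(* Chernoff's method; [B] is an extra event independent of the [E j], so that no
   separate passage from boxes to general events is needed. *)
Lemma hoeffding_bernoulli {d} (T : measurableType d) (R : realType)
    (Pr : probability T R) (m : nat) (E : 'I_m -> set T) (B : set T)
    (p e a : R) :
  measurable B -> (forall j, measurable (E j)) -> 0 <= p <= 1 -> 0 <= e ->
  m%:R * (p + e) <= a ->
  (forall c : {ffun 'I_m -> bool},
    Pr (B `&` \bigcap_(j in [set: 'I_m]) (if c j then E j else ~` E j)) =
    (Pr B * (\prod_(j < m) (if c j then p else 1 - p))%R%:E)%E) ->
  (Pr (B `&` [set w | (a <= \sum_(j < m) \1_(E j) w)%R]) <=
    Pr B * (expR (- 2 * m%:R * e ^+ 2))%R%:E)%E.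
Proof.
move=> mB mE p01 e0 am boxE; have /andP[p0 p1] := p01.
pose box (c : {ffun 'I_m -> bool}) :=
  B `&` \bigcap_(j in [set: 'I_m]) (if c j then E j else ~` E j).
pose cnt (c : {ffun 'I_m -> bool}) : R := \sum_(j < m) (c j)%:R.
pose pr (c : {ffun 'I_m -> bool}) : R := \prod_(j < m) (if c j then p else 1 - p).
have pr0 c : 0 <= pr c.
  by apply: prodr_ge0 => j _; case: ifP; rewrite ?subr_ge0.
have mbox c : measurable (box c).
  apply: measurableI => //; apply: fin_bigcap_measurable => // j _.
  by case: ifP => // _; exact: measurableC.
have mS : measurable (B `&` [set w | a <= \sum_(j < m) \1_(E j) w]).
  apply: measurableI => //; rewrite -[X in measurable X]setTI.
  apply: measurable_fun_le => //; apply: measurable_sum => j.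
  exact: measurable_indic.
apply: (@le_trans _ _ (\sum_(c | (a <= cnt c)%R) Pr (box c))%E).
  apply: le_measure_bigcup_fin => // w [Bw aw].
  pose c := [ffun j => w \in E j]; exists c.
    apply: le_trans aw _; apply: ler_sum => j _.
    by rewrite ffunE indicE.
  split=> // j _; rewrite ffunE; case: ifPn; first by rewrite inE.
  by rewrite notin_setE.
under eq_bigr do rewrite boxE.
rewrite -ge0_sume_distrr//; last by move=> c _; rewrite lee_fin; exact: pr0.
rewrite sumEFin lee_wpmul2l// lee_fin.
(* This value minimises [lam ^+ 2 / 8 - lam * e]; the minimum is [- 2 * e ^+ 2]. *)
pose lam := 4 * e.
have lam0 : 0 <= lam by rewrite mulr_ge0.
apply: (@le_trans _ _ (\sum_(c : {ffun 'I_m -> bool})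
    expR (lam * (cnt c - a)) * pr c)).
  rewrite big_mkcond/=; apply: ler_sum => c _; case: ifPn => [ac|_].
    by rewrite ler_peMl ?pr0// -[leLHS]expR0 ler_expR mulr_ge0// subr_ge0.
  by rewrite mulr_ge0// expR_ge0.
have -> : \sum_(c : {ffun 'I_m -> bool}) expR (lam * (cnt c - a)) * pr c =
    expR (- (lam * a)) * (1 - p + p * expR lam) ^+ m.
  rewrite -sum_prod_bernoulli mulr_sumr; apply: eq_bigr => c _.
  rewrite mulrBr addrC expRD -mulrA; congr (_ * _).
  rewrite big_split/= mulrC; congr (_ * _).
  rewrite /cnt mulr_sumr expR_sum; apply: eq_bigr => j _.
  by case: (c j); rewrite ?mulr1// mulr0 expR0.
apply: (@le_trans _ _ (expR (- (lam * a)) * expR (p * lam + lam ^+ 2 / 8) ^+ m)).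
  rewrite ler_wpM2l ?expR_ge0// lerXn2r ?nnegrE ?expR_ge0//.
    by rewrite addr_ge0 ?subr_ge0// mulr_ge0// expR_ge0.
  exact: bernoulli_mgf_le.
rewrite -expRM_natl -expRD ler_expR /lam.
have := ler_wpM2l lam0 am; rewrite /lam; lra.
Qed.

(** * Quantiles and empirical distribution functions *)

Lemma itvNyoEbigcup (R : realType) (x : R) :
  `]-oo, x[%classic = \bigcup_n `]-oo, x - n.+1%:R^-1]%classic.
Proof.
apply/seteqP; split => [y|y [n _]]; rewrite /= !in_itv/=.
  move=> /ltr_add_invr[n yx]; exists n => //=.
  by rewrite in_itv/= lerBrDr ltW.
by move=> /le_lt_trans; apply; rewrite ltrBlDr ltrDl invr_gt0 ltr0n.
Qed.

(** Take the infimum of the points where the c.d.f. reaches [b]: right continuity treats the closed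
    half-line, continuity from below the open one. The two half-lines differ when there is an atom
    at [q]. *)
Lemma exists_quantile {d} (T : measurableType d) (R : realType)
    (mu : probability T R) (X : T -> R) (b : R) :
  measurable_fun setT X -> 0 < b < 1 ->
  exists q, (mu (X @^-1` `]-oo, q[) <= b%:E)%E /\
            (b%:E <= mu (X @^-1` `]-oo, q]))%E.
Proof.
move=> mX /andP[b0 b1].
have mpre (A : set R) : measurable A -> measurable (X @^-1` A).
  by move=> mA; rewrite -[X in measurable X]setTI; exact: mX.
pose Y : {RV mu >-> R} := HB.pack X (isMeasurableFun.Build _ _ _ _ X mX).
pose E := [set x | (b%:E <= cdf Y x)%E].
have E_out x : ~ E x -> (cdf Y x <= b%:E)%E by move=> /negP; rewrite -ltNge => /ltW.
have E0 : E !=set0.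
  apply/set0P/negP => /eqP E0.
  have : (1 <= b%:E)%E.
    apply: cvge_le (cvg_cdfy1 Y); apply: nearW => x.
    by apply: E_out; rewrite E0.
  by rewrite lee_fin leNgt b1.
have lbE : has_lbound E.
  apply: contrapT => nlb.
  have : (b%:E <= 0)%E.
    apply: cvge_ge (cvg_cdfNy0 Y); apply: nearW => x.
    apply: contrapT => /negP; rewrite -ltNge => Fx.
    apply: nlb; exists x => y Ey; rewrite leNgt; apply/negP => /ltW yx.
    by move: Fx; rewrite ltNge (le_trans Ey)// cdf_nondecreasing.
  by rewrite lee_fin leNgt b0.
exists (inf E); split.
  have : (mu (X @^-1` `]-oo, (inf E - n.+1%:R^-1)%R]) @[n --> \oo] -->
      mu (X @^-1` `]-oo, inf E[))%E.
    rewrite itvNyoEbigcup preimage_bigcup.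
    apply: nondecreasing_cvg_mu => [n||m n mn].
    - exact: mpre.
    - by apply: bigcup_measurable => n _; exact: mpre.
    - apply/subsetPset; apply: preimage_subset; apply: subset_itvl.
      by rewrite bnd_simp lerB// lef_pV2 ?posrE// ler_nat.
  apply: cvge_le; apply: nearW => n; apply: (E_out) => En.
  have : inf E <= inf E - n.+1%:R^-1 by exact: ge_inf.
  by rewrite leNgt ltrBlDr ltrDl invr_gt0 ltr0n.
have cr := @cdf_right_continuous _ _ _ _ Y (inf E).
suff : (b%:E <= cdf Y (inf E))%E by [].
apply: cvge_ge cr.
near=> r.
have [y Ey yr] : exists2 y, E y & y < r.
  by apply: inf_lt => //; near: r; exact: nbhs_right_gt.
by apply: le_trans Ey _; apply: cdf_nondecreasing; exact: ltW.
Unshelve. all: by end_near. Qed.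

Lemma measurable_quantile {d} (T : measurableType d) (R : realType)
    (b : R) (G : T -> R -> R) :
  (forall x, measurable_fun setT (G ^~ x)) ->
  (forall w, {homo G w : x y / x <= y}) ->
  (forall w, has_inf [set q | b <= G w q]) ->
  measurable_fun setT (fun w => quantile b (G w)).
Proof.
move=> mG ndG infG _.
apply: (measurability _ (RGenInftyO.measurableE R)) => //.
move=> _ [_ [x ->] <-]; rewrite setTI.
(* By monotonicity, the infimum lies below [x] exactly when some rational below [x] reaches the
   level [b]; the union is countable. *)
rewrite (_ : _ @^-1` _ = \bigcup_(r : rat)
    [set w | ratr r < x /\ b <= G w (ratr r)]).
  apply: bigcupT_measurable_rat => r.
  have [rx|xr] := ltP (ratr r) x.
    rewrite (_ : [set w | _] = setT `&` [set w | b <= G w (ratr r)]).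
      exact: measurable_fun_le.
    by apply/seteqP; split => w //= -[].
  rewrite (_ : [set w | _] = set0)//.
  by apply/seteqP; split => w //= [].
apply/seteqP; split => w /=; rewrite in_itv/=.
  move=> /(inf_lt (infG w).1)[q /= bq qx].
  have [r] := rat_in_itvoo qx; rewrite in_itv/= => /andP[qr rx].
  by exists r => //; split => //; apply: le_trans bq _; apply: ndG; exact: ltW.
move=> [r _ [rx br]]; apply: le_lt_trans rx.
by apply: ge_inf => //; exact: (infG w).2.
Qed.

Definition ecdf {R : realType} {m : nat} (v : 'I_m -> R) (x : R) : R :=
  (\sum_(j < m) ((v j <= x)%R : bool)%:R) / m%:R.

(** The initial value [1] bounds every empirical c.d.f., so it leaves the minimum unchanged when
    [d > 0]. *)
Definition min_ecdf {R : realType} {d : nat} {m : 'I_d -> nat}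
    (v : forall i, 'I_(m i) -> R) (x : R) : R :=
  \big[Num.min/1]_(i < d) ecdf (v i) x.

Section ecdf.
Context {R : realType}.

Lemma ecdf_nondecreasing (m : nat) (v : 'I_m -> R) :
  {homo ecdf v : x y / x <= y}.
Proof.
move=> x y xy; rewrite ler_wpM2r ?invr_ge0// ler_sum// => j _.
by rewrite ler_nat; case: (leP (v j) x) => // /le_trans ->.
Qed.

Lemma min_ecdf_nondecreasing (d : nat) (m : 'I_d -> nat)
    (v : forall i, 'I_(m i) -> R) :
  {homo min_ecdf v : x y / x <= y}.
Proof.
move=> x y xy; apply: le_bigmin; first exact: bigmin_le_id.
move=> i _; apply: le_trans (ecdf_nondecreasing _ _ _ _ xy).
exact: (@bigmin_le _ _ _ 1 i (fun i => ecdf (v i) x)).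
Qed.

Lemma ecdf_gt0 (m : nat) (v : 'I_m -> R) (x : R) :
  0 < ecdf v x -> exists j, v j <= x.
Proof.
move=> e0; apply: contrapT => nv; move: e0; rewrite /ecdf big1 ?mul0r ?ltxx//.
by move=> j _; case: leP => // vx; case: nv; exists j.
Qed.

Lemma ecdf_eq1 (m : nat) (v : 'I_m -> R) (x : R) :
  (0 < m)%N -> (forall j, v j <= x) -> ecdf v x = 1.
Proof.
move=> m0 vx; rewrite /ecdf; under eq_bigr do rewrite vx.
by rewrite sumr_const card_ord divff// pnatr_eq0 -lt0n.
Qed.

(** The strict count matters: at a quantile, only the mass of the open half-line is bounded
    above. *)
Lemma ecdf_le_count_lt (m : nat) (v : 'I_m -> R) (x q : R) : (0 < m)%N -> x < q ->
  ecdf v x * m%:R <= \sum_(j < m) ((v j < q)%R : bool)%:R.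
Proof.
move=> m0 xq; rewrite divfK ?pnatr_eq0 -?lt0n//; apply: ler_sum => j _.
by rewrite ler_nat; case: (leP (v j) x) => // /le_lt_trans ->.
Qed.

(** This rules out the default value of [inf]. A level at most [1] is reached beyond all sample
    points, and a positive level is not reached below all of them. *)
Lemma has_inf_min_ecdf (d : nat) (m : 'I_d -> nat)
    (v : forall i, 'I_(m i) -> R) (b : R) :
  (0 < d)%N -> (forall i, (0 < m i)%N) -> 0 < b <= 1 ->
  has_inf [set q | b <= min_ecdf v q].
Proof.
move=> d0 m0 /andP[b0 b1].
pose M := \sum_(i < d) \sum_(j < m i) `|v i j|.
have vM i j : `|v i j| <= M.
  rewrite /M (bigD1 i)//= (bigD1 j)//= -addrA lerDl addr_ge0 ?sumr_ge0// => k _.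
  exact: sumr_ge0.
split.
  exists M => /=; apply: le_bigmin => // i _; rewrite ecdf_eq1// => j.
  exact: le_trans (ler_norm _) (vM i j).
exists (- M) => q /= bq; pose i0 := Ordinal d0.
have /ecdf_gt0[j vq] : 0 < ecdf (v i0) q.
  apply: lt_le_trans b0 (le_trans bq _).
  exact: (@bigmin_le _ _ _ 1 i0 (fun i => ecdf (v i) q)).
apply: le_trans vq; have := vM i0 j; rewrite ler_norml => /andP[]//.
Qed.

Lemma measurable_min_ecdf {dT} (T : measurableType dT) (d : nat)
    (m : 'I_d -> nat) (V : forall i, 'I_(m i) -> T -> R) (x : R) :
  (forall i j, measurable_fun setT (V i j)) ->
  measurable_fun setT (fun w => min_ecdf (fun i j => V i j w) x).
Proof.
move=> mV; rewrite /min_ecdf.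
elim: (index_enum _) => [|i r IH].
  under eq_fun do rewrite big_nil.
  exact: measurable_cst.
under eq_fun do rewrite big_cons.
apply: measurable_minr => //; apply: measurable_funM => //.
apply: measurable_sum => j.
rewrite (_ : (fun _ => _) = \1_(V i j @^-1` `]-oo, x])); last first.
  apply/funext => w; rewrite indicE; congr (_%:R); congr nat_of_bool.
  by apply/idP/idP; rewrite inE /= in_itv.
by apply: measurable_indic; rewrite -[X in measurable X]setTI; exact: mV.
Qed.

End ecdf.

(** * The coverage bound *)

Theorem theorem8 (R : realType)
  (dX dY dO : measure_display)
  (X : measurableType dX) (Y : measurableType dY) (Omega : measurableType dO)
  (Pr : probability Omega R)
  (s : (X * Y)%type -> R) (s_meas : measurable_fun setT s)
  (d : nat) (d_pos : (0 < d)%N)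
  (S : 'I_d -> probability (X * Y)%type R)
  (f : R -> \bar R) (f_gen : fdiv_generator f)
  (rho alpha : R) (rho_pos : 0 < rho) (alpha_bds : 0 < alpha < 1)
  (m : 'I_d -> nat) (m_pos : forall i, (0 < m i)%N)
  (* source samples (X_ij, Y_ij) *)
  (Z : forall i : 'I_d, 'I_(m i) -> Omega -> (X * Y)%type)
  (Z_meas : forall i j, measurable_fun setT (Z i j))
  (Z_law : forall i j A, measurable A -> Pr (Z i j @^-1` A) = S i A)
  (Z_indep : forall i (A : 'I_(m i) -> set (X * Y)%type),
      (forall j, measurable (A j)) ->
      Pr (\bigcap_(j in [set: 'I_(m i)]) (Z i j @^-1` A j))
      = (\prod_(j < m i) Pr (Z i j @^-1` A j))%E)
  (* test point (X_{n+1}, Y_{n+1}) *)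
  (Znew : Omega -> (X * Y)%type) (Znew_meas : measurable_fun setT Znew)
  (* law P of V_{n+1} = s(X_{n+1}, Y_{n+1}) *)
  (P : probability R R)
  (Vnew_law : forall A, measurable A -> Pr ((s \o Znew) @^-1` A) = P A)
  (P_in : exists P0 : probability R R,
      in_convex_hull (fun i => pushfwd s (S i)) P0 /\ (fdiv f P P0 <= rho%:E)%E)
  (Vnew_indep : forall (B : set R) (A : forall i : 'I_d, 'I_(m i) -> set R),
      measurable B -> (forall i j, measurable (A i j)) ->
      Pr ((s \o Znew) @^-1` B `&`
          \bigcap_(i in [set: 'I_d]) \bigcap_(j in [set: 'I_(m i)])
             ((s \o Z i j) @^-1` A i j))
      = (Pr ((s \o Znew) @^-1` B) *
         Pr (\bigcap_(i in [set: 'I_d]) \bigcap_(j in [set: 'I_(m i)])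
               ((s \o Z i j) @^-1` A i j)))%E)
  (eps : R) (eps_pos : 0 < eps) :
  let rho_star : \bar R :=
    ereal_inf [set fdiv f P P0 | P0 in
                 [set P0 : probability R R |
                    in_convex_hull (fun i => pushfwd s (S i)) P0]] in
  let Fhat (i : 'I_d) (w : Omega) (x : R) : R :=
    (\sum_(j < m i) ((s (Z i j w) <= x)%R : bool)%:R) / (m i)%:R in
  let Fmin (w : Omega) (x : R) : R := \big[Num.min/1]_(i < d) Fhat i w x in
  let t (w : Omega) : R := quantile (gfun_inv f rho%:E (1 - alpha)) (Fmin w) in
  let Ctilde (w : Omega) (x : X) : set Y := [set y | s (x, y) <= t w] in
  (Pr [set w | Ctilde w (Znew w).1 (Znew w).2] >=
   ((1 - 2 * \sum_(i < d) expR (- 2 * (m i)%:R * eps ^+ 2)) *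
    gfun f rho_star (gfun_inv f rho%:E (1 - alpha) - eps))%:E)%E.
Proof.
pose rho_star : \bar R := ereal_inf [set fdiv f P P0 | P0 in
  [set P0 : probability R R | in_convex_hull (fun i => pushfwd s (S i)) P0]].
pose V i j w := s (Z i j w).
pose Fmin w := min_ecdf (fun i j => V i j w).
pose beta := gfun_inv f rho%:E (1 - alpha).
pose t w := quantile beta (Fmin w).
pose C := [set w | s (Znew w) <= t w].
pose b := beta - eps.
suff : (((1 - 2 * \sum_(i < d) expR (- 2 * (m i)%:R * eps ^+ 2)) *
    gfun f rho_star b)%R%:E <= Pr C)%E.
  rewrite (_ : C = [set w | s ((Znew w).1, (Znew w).2) <= t w])//.
  by apply/seteqP; split => w; rewrite /C /= -surjective_pairing.
have rho_star0 : (0 <= rho_star)%E.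
  by apply: le_ereal_inf_tmp => _ [P0 _ <-]; exact: fdiv_ge0.
(* [gfun] clamps its argument to [[0, 1]], so it vanishes here and the bound reads [0 <= Pr C]. *)
have [b0|b0] := leP b 0; first by rewrite gfun_le0// mulr0.
have beta1 : beta <= 1 by exact: gfun_inv_le1.
have beta0 : 0 < beta by rewrite /b in b0; lra.
have b1 : b < 1 by rewrite /b; lra.
have b01 : 0 < b < 1 by rewrite b0.
have mV i j : measurable_fun setT (V i j).
  exact: (measurableT_comp s_meas (Z_meas i j)).
have mVnew : measurable_fun setT (s \o Znew) by exact: measurableT_comp.
have mpre (X0 : Omega -> R) (A : set R) :
    measurable_fun setT X0 -> measurable A -> measurable (X0 @^-1` A).
  by move=> mX mA; rewrite -[X in measurable X]setTI; exact: mX.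
have mspre (A : set R) : measurable A -> measurable (s @^-1` A).
  by move=> mA; rewrite -[X in measurable X]setTI; exact: s_meas.
have infF w : has_inf [set q | beta <= Fmin w q].
  by apply: (has_inf_min_ecdf d m (fun i j => V i j w)); rewrite // beta0.
have mt : measurable_fun setT t.
  apply: (measurable_quantile Omega R beta Fmin) => //.
  - by move=> x; exact: (measurable_min_ecdf Omega d m V x mV).
  - move=> w x y.
    exact: (min_ecdf_nondecreasing d m (fun i j => V i j w)).
have /choice[q qP] : forall i, exists q,
    (S i (s @^-1` `]-oo, q[) <= b%:E)%E /\ (b%:E <= S i (s @^-1` `]-oo, q]))%E.
  by move=> i; exact: exists_quantile.
pose i0 := [arg max_(i > Ordinal d_pos) q i]%O.
have q_max i : q i <= q i0 by rewrite /i0; case: arg_maxP => // k _; exact.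
set q0 := q i0 in q_max.
have q0_ge i : (b%:E <= pushfwd s (S i) `]-oo, q0]%classic)%E.
  apply: le_trans (qP i).2 _; apply: le_measure; rewrite ?inE; [exact: mspre..|].
  by apply: preimage_subset; apply: subset_itvl; rewrite bnd_simp.
pose B := (s \o Znew) @^-1` `]-oo, q0].
pose p := fine (P `]-oo, q0]%classic).
have PB : Pr B = p%:E by rewrite Vnew_law// fineK// fin_num_measure.
have mB : measurable B by exact: mpre.
have gp : gfun f rho_star b <= p by apply: gfun_hull_le => //; exact: ltW.
pose E (j : 'I_(m i0)) := (s \o Z i0 j) @^-1` `]-oo, q0[.
pose e := expR (- 2 * (m i0)%:R * eps ^+ 2).
pose bad := [set w | beta * (m i0)%:R <= \sum_(j < m i0) \1_(E j) w].
have mE j : measurable (E j) by exact: (mpre _ _ (mV i0 j)).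
have mbad : measurable bad.
  rewrite -[X in measurable X]setTI; apply: measurable_fun_le => //.
  by apply: measurable_sum => j; exact: measurable_indic.
have Pr_bad : (Pr (B `&` bad) <= (p * e)%:E)%E.
  pose J : set R := `]-oo, q0[%classic.
  have mJ : measurable J by exact: measurable_itv.
  pose p0 := fine (S i0 (s @^-1` J)).
  have p0E : S i0 (s @^-1` J) = p0%:E by rewrite fineK ?fin_num_measure//; exact: mspre.
  have p0b : p0 <= b by rewrite -lee_fin -p0E; exact: (qP i0).1.
  have p0_ge0 : 0 <= p0 by exact: fine_ge0.
  rewrite EFinM -PB.
  (* The success probability satisfies [p0 <= b], hence [p0 + eps <= beta]. *)
  apply: (hoeffding_bernoulli Omega R Pr (m i0) E B p0) => //.
  - by rewrite p0_ge0; lra.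
  - exact: ltW.
  - by rewrite mulrC ler_wpM2r//; move: p0b; rewrite /b; lra.
  move=> c.
  pose D j : set R := if c j then J else ~` J.
  have mD j : measurable (D j) by rewrite /D; case: (c j) => //; exact: measurableC.
  (* The type ['I_(m i)] depends on [i], so the sets [D j] of sample [i0] are passed through natural
     numbers; [setT] leaves the other samples unconstrained. *)
  pose c' (k : nat) : set R := if insub k is Some j then D j else setT.
  pose A i (j : 'I_(m i)) : set R := if i == i0 then c' j else setT.
  have A_i0 j : A i0 j = D j by rewrite /A eqxx /c' valK.
  have mA i j : measurable (A i j).
    by rewrite /A; case: ifP => // _; rewrite /c'; case: insub.
  have ED j : (if c j then E j else ~` E j) = Z i0 j @^-1` (s @^-1` D j).
    by rewrite /D /E /J; case: (c j).
  have AE : \bigcap_(i in [set: 'I_d]) \bigcap_(j in [set: 'I_(m i)])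
      ((s \o Z i j) @^-1` A i j) =
      \bigcap_(j in [set: 'I_(m i0)]) (Z i0 j @^-1` (s @^-1` D j)).
    apply/seteqP; split => [w Aw j _|w Dw i _ j _].
      by have := Aw i0 I j I; rewrite /= A_i0.
    have [ii0|ne] := eqVneq i i0; last by rewrite /A (negbTE ne).
    by subst i; rewrite A_i0; exact: (Dw j I).
  under eq_bigcapr do rewrite ED.
  rewrite -AE Vnew_indep// AE; congr (_ * _)%E.
  rewrite Z_indep; last by move=> j; exact: mspre.
  rewrite -prodEFin; apply: eq_bigr => j _.
  rewrite Z_law; last exact: mspre.
  rewrite /D; case: (c j); first exact: p0E.
  by rewrite -[s @^-1` (~` J)]/(~` (s @^-1` J)) probability_setC ?p0E//; exact: mspre.
have mC : measurable C.
  by rewrite -[X in measurable X]setTI; exact: measurable_fun_le.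
(* Off [bad], every [x] with [beta <= Fmin w x] satisfies [q0 <= x], hence [q0 <= t w]; on [B] the
   new score is then covered. *)
have BC : B `<=` (B `&` bad) `|` C.
  move=> w Bw; have [wbad|wgood] := pselect (bad w); [by left|right].
  rewrite /C /=; move: (Bw); rewrite /B /= in_itv/= => /le_trans; apply.
  apply: lb_le_inf; first exact: (infF w).1.
  move=> x /= bx; rewrite leNgt; apply/negP => xq; apply: wgood.
  have h : beta <= ecdf ((V i0)^~ w) x.
    by apply: le_trans bx _; exact: (@bigmin_le _ _ _ 1 i0 (fun i => ecdf ((V i)^~ w) x)).
  apply: (@le_trans _ _ (ecdf ((V i0)^~ w) x * (m i0)%:R)).
    by rewrite ler_wpM2r.
  apply: le_trans (ecdf_le_count_lt _ (fun j => V i0 j w) _ _ (m_pos i0) xq) _.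
  apply: ler_sum => j _; rewrite indicE ler_nat.
  by case: ltP => // vq; rewrite mem_set// /E /= in_itv.
have pC : (p%:E <= (p * e)%:E + Pr C)%E.
  rewrite -PB; apply: le_trans (leeD Pr_bad (lexx _)).
  apply: le_trans (measureU2 _ _ _) => //; last exact: measurableI.
  apply: le_measure; rewrite ?inE//; apply: measurableU => //; exact: measurableI.
have PrC : Pr C = (fine (Pr C))%:E by rewrite fineK// fin_num_measure.
rewrite PrC lee_fin; rewrite PrC -EFinD lee_fin in pC.
have e1 : e <= 1.
  rewrite -expR0 ler_expR mulNr mulNr oppr_le0 mulr_ge0 ?sqr_ge0//.
have e_sum : e <= \sum_(i < d) expR (- 2 * (m i)%:R * eps ^+ 2).
  rewrite (bigD1 i0)//= lerDl; apply: sumr_ge0 => i _; exact: expR_ge0.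
have e0 : 0 <= e by exact: expR_ge0.
(* [e] is one term of a sum of nonnegative terms, and doubling the sum only weakens the bound. *)
apply: (@le_trans _ _ ((1 - e) * gfun f rho_star b)).
  by rewrite ler_wpM2r ?gfun_ge0//; lra.
apply: (@le_trans _ _ ((1 - e) * p)); last lra.
by rewrite ler_wpM2l// subr_ge0.
Qed.
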